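(* Let $X$ and $Y$ be Banach spaces such that $\mathrm{QNA}(X,Y)$ is dense in $\mathcal{L}(X,Y)$. (a) If $X_1$ is an absolute summand of $X$ of type $1$, then $\mathrm{QNA}(X_1,Y)$ is dense in $\mathcal{L}(X_1,Y)$. (b) In particular, if $X_1$ is an $L$-summand of $X$, then $\mathrm{QNA}(X_1,Y)$ is dense in $\mathcal{L}(X_1,Y)$. (c) If $Y_1$ is an absolute summand of $Y$, then $\mathrm{QNA}(X,Y_1)$ is dense in $\mathcal{L}(X,Y_1)$.
   Context: Banach spaces are over $\mathbb{K}=\mathbb{R}$ or $\mathbb{C}$; $B_X$ is the closed unit ball of $X$; $\mathcal{L}(X,Y)$ is the space of bounded linear operators with the operator norm. $T\in\mathcal{L}(X,Y)$ is quasi norm attaining, $T\in\mathrm{QNA}(X,Y)$, if there is $u\in\overline{T(B_X)}$ (norm closure) with $\|u\|=\|T\|$. An absolute norm is a norm $|\cdot|_a$ on $\mathbb{R}^2$ with $|(1,0)|_a=|(0,1)|_a=1$ and $|(s,t)|_a=|(|s|,|t|)|_a$ for all $s,t\in\mathbb{R}$. The absolute sum $X_1\oplus_a X_2$ is $X_1\times X_2$ with the norm $\|(x_1,x_2)\|_a=|(\|x_1\|,\|x_2\|)|_a$. A closed subspace $X_1$ of $X$ is an absolute summand if $X=X_1\oplus_a X_2$ (isometrically, via $x_1+x_2\leftrightarrow(x_1,x_2)$) for some absolute norm $|\cdot|_a$ and some closed subspace $X_2$ of $X$; it is an absolute summand of type $1$ if $|\cdot|_a$ can be taken of type $1$. The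 absolute norm $|\cdot|_a$ is of type $1$ if $(1,0)$ is a vertex of the unit ball of $(\mathbb{R}^2,|\cdot|_a)$, i.e. the set of norm-one functionals attaining the value $1$ at $(1,0)$, namely $\{(1,t): t\in\mathbb{R},\ |(1,t)|_{a^*}=1\}$, separates the points of $\mathbb{R}^2$, where $|\cdot|_{a^*}$ is the dual norm of $|\cdot|_a$ under the pairing $\langle (s,t),(x,y)\rangle=sx+ty$. $X_1$ is an $L$-summand if $X=X_1\oplus_1 X_2$ with $|(s,t)|_1=|s|+|t|$. *)

(* Defs.v *)
From Stdlib Require Import Reals Lra ProofIrrelevance.
From Coquelicot Require Import Coquelicot.

Set Implicit Arguments.
Unset Strict Implicit.
Unset Printing Implicit Defensive.

Open Scope R_scope.

Section Operators.

Context {K : AbsRing} {X Y : NormedModule K}.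

(* The library predicate [is_linear] already includes boundedness, so it is
   membership in L(X,Y).  The supremum below is finite for such operators, and
   [real] of an infinite supremum (unbounded maps) is a junk value. *)
Definition op_norm (T : X -> Y) : R :=
  real (Lub_Rbar (fun r => exists x : X, norm x <= 1 /\ r = norm (T x))).

Definition in_norm_closure (A : Y -> Prop) (u : Y) : Prop :=
  forall eps : posreal, exists y, A y /\ norm (minus y u) < eps.

Definition image_unit_ball (T : X -> Y) (y : Y) : Prop :=
  exists x : X, norm x <= 1 /\ y = T x.

Definition QNA (T : X -> Y) : Prop :=
  is_linear T /\
  exists u : Y, in_norm_closure (image_unit_ball T) u /\ norm u = op_norm T.

End Operators.

Definition QNA_dense {K : AbsRing} (X Y : NormedModule K) : Prop :=
  forall S : X -> Y, is_linear S ->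
  forall eps : posreal, exists T : X -> Y,
    QNA T /\ op_norm (fun x => minus (T x) (S x)) < eps.

Record closed_subspace {K : AbsRing} (X : NormedModule K) := ClosedSubspace {
  carrier :> X -> Prop;
  carrier_zero : carrier zero;
  carrier_plus : forall x y, carrier x -> carrier y -> carrier (plus x y);
  carrier_scal : forall (k : K) x, carrier x -> carrier (scal k x);
  carrier_closed : closed carrier
}.

(* A closed subspace as a normed space in its own right, with the operations,
   the norm and the uniform structure inherited from the ambient space. *)
Section Subspace.

Context {K : AbsRing} {X : NormedModule K} (W : closed_subspace X).

Definition sub_type : Type := {x : X | W x}.

Lemma sub_eq (x y : sub_type) : proj1_sig x = proj1_sig y -> x = y.
Proof.
  destruct x as [x hx], y as [y hy]; simpl; intros <-.
  f_equal; apply proof_irrelevance.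
Qed.

Lemma carrier_opp (x : X) : W x -> W (opp x).
Proof.
  intros hx.
  exact (eq_ind _ (carrier W) (carrier_scal (opp one) hx) _ (scal_opp_one x)).
Qed.

Definition sub_zero : sub_type := exist _ zero (carrier_zero W).
Definition sub_plus (x y : sub_type) : sub_type :=
  exist _ (plus (proj1_sig x) (proj1_sig y))
    (carrier_plus (proj2_sig x) (proj2_sig y)).
Definition sub_opp (x : sub_type) : sub_type :=
  exist _ (opp (proj1_sig x)) (carrier_opp (proj2_sig x)).
Definition sub_scal (k : K) (x : sub_type) : sub_type :=
  exist _ (scal k (proj1_sig x)) (carrier_scal k (proj2_sig x)).

Lemma sub_plus_comm (x y : sub_type) : sub_plus x y = sub_plus y x.
Proof. apply sub_eq, plus_comm. Qed.
Lemma sub_plus_assoc (x y z : sub_type) :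
  sub_plus x (sub_plus y z) = sub_plus (sub_plus x y) z.
Proof. apply sub_eq, plus_assoc. Qed.
Lemma sub_plus_zero_r (x : sub_type) : sub_plus x sub_zero = x.
Proof. apply sub_eq; exact (plus_zero_r (proj1_sig x)). Qed.
Lemma sub_plus_opp_r (x : sub_type) : sub_plus x (sub_opp x) = sub_zero.
Proof. apply sub_eq; exact (plus_opp_r (proj1_sig x)). Qed.

Definition sub_AbelianMonoid_mixin :=
  AbelianMonoid.Mixin sub_type sub_plus sub_zero
    sub_plus_comm sub_plus_assoc sub_plus_zero_r.
Canonical sub_AbelianMonoid :=
  AbelianMonoid.Pack sub_type sub_AbelianMonoid_mixin sub_type.

Definition sub_AbelianGroup_mixin :=
  AbelianGroup.Mixin sub_AbelianMonoid sub_opp sub_plus_opp_r.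
Canonical sub_AbelianGroup :=
  AbelianGroup.Pack sub_type
    (AbelianGroup.Class sub_type sub_AbelianMonoid_mixin sub_AbelianGroup_mixin)
    sub_type.

Lemma sub_scal_assoc (a b : K) (x : sub_type) :
  sub_scal a (sub_scal b x) = sub_scal (mult a b) x.
Proof. apply sub_eq, scal_assoc. Qed.
Lemma sub_scal_one (x : sub_type) : sub_scal one x = x.
Proof. apply sub_eq; exact (scal_one (proj1_sig x)). Qed.
Lemma sub_scal_distr_l (a : K) (x y : sub_type) :
  sub_scal a (plus x y) = plus (sub_scal a x) (sub_scal a y).
Proof. apply sub_eq; exact (scal_distr_l a (proj1_sig x) (proj1_sig y)). Qed.
Lemma sub_scal_distr_r (a b : K) (x : sub_type) :
  sub_scal (plus a b) x = plus (sub_scal a x) (sub_scal b x).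
Proof. apply sub_eq; exact (scal_distr_r a b (proj1_sig x)). Qed.

Definition sub_ModuleSpace_mixin :=
  ModuleSpace.Mixin K sub_AbelianGroup sub_scal
    sub_scal_assoc sub_scal_one sub_scal_distr_l sub_scal_distr_r.
Definition sub_ModuleSpace_class :=
  ModuleSpace.Class K sub_type (AbelianGroup.class sub_AbelianGroup)
    sub_ModuleSpace_mixin.
Canonical sub_ModuleSpace :=
  ModuleSpace.Pack K sub_type sub_ModuleSpace_class sub_type.

Definition sub_ball (x : sub_type) (e : R) (y : sub_type) : Prop :=
  ball (proj1_sig x) e (proj1_sig y).

Lemma sub_ball_center (x : sub_type) (e : posreal) : sub_ball x e x.
Proof. exact (ball_center (proj1_sig x) e). Qed.
Lemma sub_ball_sym (x y : sub_type) (e : R) : sub_ball x e y -> sub_ball y e x.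
Proof. exact (ball_sym (proj1_sig x) (proj1_sig y) e). Qed.
Lemma sub_ball_triangle (x y z : sub_type) (e1 e2 : R) :
  sub_ball x e1 y -> sub_ball y e2 z -> sub_ball x (e1 + e2) z.
Proof.
  exact (ball_triangle (proj1_sig x) (proj1_sig y) (proj1_sig z) e1 e2).
Qed.

Definition sub_UniformSpace_mixin :=
  UniformSpace.Mixin sub_type sub_zero sub_ball
    sub_ball_center sub_ball_sym sub_ball_triangle.
Canonical sub_UniformSpace :=
  UniformSpace.Pack sub_type sub_UniformSpace_mixin sub_type.

Definition sub_NormedModuleAux_class :=
  NormedModuleAux.Class K sub_type sub_ModuleSpace_class sub_UniformSpace_mixin.
Canonical sub_NormedModuleAux :=
  NormedModuleAux.Pack K sub_type sub_NormedModuleAux_class sub_type.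

Definition sub_norm (x : sub_type) : R := norm (proj1_sig x).

Lemma sub_norm_triangle (x y : sub_type) :
  sub_norm (plus x y) <= sub_norm x + sub_norm y.
Proof. exact (norm_triangle (proj1_sig x) (proj1_sig y)). Qed.
Lemma sub_norm_scal (k : K) (x : sub_type) :
  sub_norm (scal k x) <= abs k * sub_norm x.
Proof. exact (norm_scal k (proj1_sig x)). Qed.
Lemma sub_norm_compat1 (x y : sub_type) (e : R) :
  sub_norm (minus y x) < e -> ball x e y.
Proof. exact (norm_compat1 (proj1_sig x) (proj1_sig y) e). Qed.
Lemma sub_norm_compat2 (x y : sub_type) (e : posreal) :
  ball x e y -> sub_norm (minus y x) < @norm_factor K X * e.
Proof. exact (norm_compat2 (proj1_sig x) (proj1_sig y) e). Qed.
Lemma sub_norm_eq_zero (x : sub_type) : sub_norm x = 0 -> x = zero.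
Proof. intros h; apply sub_eq; exact (norm_eq_zero (proj1_sig x) h). Qed.

Definition sub_NormedModule_mixin :=
  NormedModule.Mixin K sub_NormedModuleAux sub_norm (@norm_factor K X)
    sub_norm_triangle sub_norm_scal sub_norm_compat1 sub_norm_compat2
    sub_norm_eq_zero.
Canonical subspace : NormedModule K :=
  NormedModule.Pack K sub_type
    (NormedModule.Class K sub_type sub_NormedModuleAux_class
       sub_NormedModule_mixin)
    sub_type.

End Subspace.

Record is_absolute_norm (N : R * R -> R) : Prop := AbsoluteNorm {
  absolute_norm_triangle : forall p q : R * R, N (plus p q) <= N p + N q;
  absolute_norm_scal : forall (c : R) (p : R * R), N (scal c p) = Rabs c * N p;
  absolute_norm_definite : forall p : R * R, N p = 0 -> p = zero;
  absolute_norm_10 : N (1, 0) = 1;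
  absolute_norm_01 : N (0, 1) = 1;
  absolute_norm_abs : forall s t : R, N (s, t) = N (Rabs s, Rabs t)
}.

Definition pairing (f p : R * R) : R := fst f * fst p + snd f * snd p.

Definition dual_norm (N : R * R -> R) (f : R * R) : R :=
  real (Lub_Rbar (fun r => exists p : R * R, N p <= 1 /\ r = Rabs (pairing f p))).

(* [e] is a vertex of the unit ball of (R^2, N): the norm-one functionals taking
   the value 1 at [e] separate the points of R^2. *)
Definition is_vertex (N : R * R -> R) (e : R * R) : Prop :=
  N e = 1 /\
  forall p q : R * R, p <> q ->
    exists f : R * R,
      dual_norm N f = 1 /\ pairing f e = 1 /\ pairing f p <> pairing f q.

Definition is_type1 (N : R * R -> R) : Prop := is_vertex N (1, 0).

Definition norm_l1 (p : R * R) : R := Rabs (fst p) + Rabs (snd p).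

Section Summands.

Context {K : AbsRing} {X : NormedModule K}.

Definition is_absolute_sum (N : R * R -> R) (X1 X2 : closed_subspace X) : Prop :=
  (forall x : X, exists! p : subspace X1 * subspace X2,
      x = plus (proj1_sig (fst p)) (proj1_sig (snd p))) /\
  (forall (x1 : subspace X1) (x2 : subspace X2),
      norm (plus (proj1_sig x1) (proj1_sig x2)) = N (norm x1, norm x2)).

Definition is_absolute_summand (X1 : closed_subspace X) : Prop :=
  exists N, is_absolute_norm N /\ exists X2, is_absolute_sum N X1 X2.

Definition is_absolute_summand_type1 (X1 : closed_subspace X) : Prop :=
  exists N, is_absolute_norm N /\ is_type1 N /\
    exists X2, is_absolute_sum N X1 X2.

Definition is_L_summand (X1 : closed_subspace X) : Prop :=
  exists X2, is_absolute_sum norm_l1 X1 X2.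

End Summands.

(* Main.v *)
(* For (a), a type-1 norm satisfies [|s| + c |t| <= N (s, t)] for some [c > 0].
   Extend [S] by zero on [X2] and approximate it by a quasi norm attaining [T].
   As [T] is small on [X2], the [X2]-components of a sequence along which [T]
   quasi attains its norm must tend to 0, so the restriction of [T] to [X1]
   quasi attains the same norm at the same point.  (b) is the case [c = 1].

   For (c), approximate [S], seen as [Y]-valued, by [T] quasi attaining its norm
   at [u = u1 + u2].  Let [(a, b)] norm [(|u1|, |u2|)] in the dual of [N] and let
   a functional [f] norm [u2].  The operator [G y = a y1 + f y2 (b / |u1|) u1]
   from [Y] to [Y1] is a contraction with [|G u| = |u|], so [G T] quasi attains
   its norm at [G u]; as [u2] is small, [a] is close to 1 and [G T] to [S].

   The functionals come from Hahn-Banach: by Zorn's lemma there is a minimal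
   sublinear functional below the norm, and minimality forces linearity. *)
Require Import Defs.
From Stdlib Require Import Reals Lra.
From Stdlib Require Import IndefiniteDescription.
From Coquelicot Require Import Coquelicot.
From mathcomp Require Import ssreflect.
From mathcomp Require boolp classical_sets.

(** * Finite suprema and infima of sets of reals *)

Lemma real_Lub_is_lub (E : R -> Prop) (M : R) :
  (exists r, E r) -> (forall r, E r -> r <= M) -> is_lub E (Lub_Rbar E).
Proof.
  intros [r0 Hr0] HM.
  destruct (Lub_Rbar_correct E) as [Hub Hmin].
  assert (H0 := Hub r0 Hr0).
  assert (HM' := Hmin (Finite M) HM).
  (* The member [r0] rules out minus infinity and the bound [M] plus infinity, the two cases where
     [real] returns a default value. *)
  destruct (Lub_Rbar E) as [l| |]; simpl in *; try easy.
  split; [exact Hub|].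
  intros b Hb; exact (Hmin (Finite b) Hb).
Qed.

Lemma real_Glb_is_glb (E : R -> Prop) (M : R) :
  (exists r, E r) -> (forall r, E r -> M <= r) ->
  (forall r, E r -> Glb_Rbar E <= r) /\
  (forall b, (forall r, E r -> b <= r) -> b <= Glb_Rbar E).
Proof.
  intros [r0 Hr0] HM.
  destruct (Glb_Rbar_correct E) as [Hlb Hmax].
  assert (H0 := Hlb r0 Hr0).
  assert (HM' := Hmax (Finite M) HM).
  destruct (Glb_Rbar E) as [l| |]; simpl in *; try easy.
  split; [exact Hlb|].
  intros b Hb; exact (Hmax (Finite b) Hb).
Qed.

Lemma Rinv_mult_le (c a b : R) : 0 < c -> / c * a <= b <-> a <= c * b.
Proof.
  intros Hc; split; intros H.
  - apply (Rmult_le_compat_l c) in H; [|lra].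
    rewrite -Rmult_assoc Rinv_r in H; lra.
  - apply (Rmult_le_compat_l (/ c)) in H; [|now left; apply Rinv_0_lt_compat].
    rewrite -Rmult_assoc Rinv_l in H; lra.
Qed.

Lemma Rle_Rinv_mult (c a b : R) : 0 < c -> a <= / c * b <-> c * a <= b.
Proof.
  intros Hc.
  assert (H := Rinv_mult_le (/ c) a b (Rinv_0_lt_compat _ Hc)).
  rewrite Rinv_inv in H; tauto.
Qed.

(** * Hahn-Banach theorem for sublinear functionals on a real module space *)

Section HahnBanach.

Context {E : ModuleSpace R_Ring}.

Definition sublinear (p : E -> R) : Prop :=
  (forall x y, p (plus x y) <= p x + p y) /\
  (forall c x, 0 < c -> p (scal c x) <= c * p x).

Lemma sublinear_zero (p : E -> R) : sublinear p -> p zero = 0.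
Proof.
  intros [_ Hs].
  assert (H1 := Hs 2 zero Rlt_0_2).
  assert (H2 := Hs (/ 2) zero (Rinv_0_lt_compat _ Rlt_0_2)).
  rewrite scal_zero_r in H1; rewrite scal_zero_r in H2; lra.
Qed.

Lemma sublinear_opp (p : E -> R) (x : E) : sublinear p -> - p (opp x) <= p x.
Proof.
  intros Hp.
  assert (H := proj1 Hp x (opp x)).
  rewrite plus_opp_r (sublinear_zero _ Hp) in H; lra.
Qed.

(** The missing inequality is the assumed one for the scalar [/ c] at the point [scal c x]. *)
Lemma sublinear_scal (p : E -> R) (c : R) (x : E) :
  sublinear p -> 0 <= c -> p (scal c x) = c * p x.
Proof.
  intros Hp [Hc|<-].
  - apply Rle_antisym; [now apply Hp|].
    assert (H := proj2 Hp (/ c) (scal c x) (Rinv_0_lt_compat _ Hc)).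
    rewrite scal_assoc in H.
    replace (mult (/ c) c) with (one : R_Ring) in H
      by (unfold mult, one; simpl; field; lra).
    rewrite scal_one in H.
    now apply Rle_Rinv_mult in H.
  - replace (scal 0 x) with (zero : E) by (symmetry; exact (scal_zero_l x)).
    rewrite (sublinear_zero _ Hp); lra.
Qed.

(* The largest sublinear functional below [p] whose value at [opp u] is
   at most [- p u]. *)
Definition linearize_at (p : E -> R) (u x : E) : R :=
  Glb_Rbar (fun r => exists t, 0 <= t /\ r = p (plus x (scal t u)) - t * p u).

Lemma linearize_at_glb (p : E -> R) (u x : E) : sublinear p ->
  (forall t, 0 <= t -> linearize_at p u x <= p (plus x (scal t u)) - t * p u) /\
  (forall b, (forall t, 0 <= t -> b <= p (plus x (scal t u)) - t * p u) ->
     b <= linearize_at p u x).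
Proof.
  intros Hp.
  destruct (real_Glb_is_glb
    (fun r => exists t, 0 <= t /\ r = p (plus x (scal t u)) - t * p u)
    (- p (opp x))) as [H1 H2].
  - exists (p (plus x (scal 0 u)) - 0 * p u), 0; lra.
  - intros r [t [Ht ->]].
    (* Splitting [scal t u] as [opp x] plus [x + t u] gives [t * p u <= p (opp x) + p (x + t u)], so
       [- p (opp x)] is a lower bound. *)
    assert (H := proj1 Hp (opp x) (plus x (scal t u))).
    rewrite plus_assoc plus_opp_l plus_zero_l in H.
    rewrite (sublinear_scal _ _ _ Hp Ht) in H; lra.
  - split.
    + intros t Ht; apply H1; now exists t.
    + intros b Hb; apply H2; intros r [t [Ht ->]]; auto.
Qed.

Lemma linearize_at_le (p : E -> R) (u x : E) :
  sublinear p -> linearize_at p u x <= p x.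
Proof.
  intros Hp.
  assert (H := proj1 (linearize_at_glb p u x Hp) 0 (Rle_refl 0)).
  replace (scal 0 u) with (zero : E) in H by (symmetry; exact (scal_zero_l u)).
  rewrite plus_zero_r in H; lra.
Qed.

Lemma linearize_at_opp (p : E -> R) (u : E) :
  sublinear p -> linearize_at p u (opp u) <= - p u.
Proof.
  intros Hp.
  assert (H := proj1 (linearize_at_glb p u (opp u) Hp) 1 Rle_0_1).
  replace (scal 1 u) with u in H by (symmetry; exact (scal_one u)).
  rewrite plus_opp_l (sublinear_zero _ Hp) in H; lra.
Qed.

(** Parameters combine: [t] for [x] and [s] for [y] make [t + s] admissible for [plus x y], and [t]
    for [x] makes [c * t] admissible for [scal c x]. The infima are then taken one at a time. *)
Lemma linearize_at_sublinear (p : E -> R) (u : E) :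
  sublinear p -> sublinear (linearize_at p u).
Proof.
  intros Hp; split.
  - intros x y.
    enough (linearize_at p u (plus x y) - linearize_at p u y
              <= linearize_at p u x) by lra.
    apply (linearize_at_glb p u x Hp); intros t Ht.
    enough (linearize_at p u (plus x y) - (p (plus x (scal t u)) - t * p u)
              <= linearize_at p u y) by lra.
    apply (linearize_at_glb p u y Hp); intros s Hs.
    assert (H := proj1 (linearize_at_glb p u (plus x y) Hp) (t + s)
      (Rplus_le_le_0_compat _ _ Ht Hs)).
    replace (plus (plus x y) (scal (t + s) u))
      with (plus (plus x (scal t u)) (plus y (scal s u))) in H.
    + assert (H' := proj1 Hp (plus x (scal t u)) (plus y (scal s u))); lra.
    + change (t + s) with (plus (t : R_Ring) s).
      rewrite scal_distr_r -!plus_assoc; f_equal.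
      rewrite !plus_assoc; f_equal; apply plus_comm.
  - intros c x Hc.
    apply Rinv_mult_le; [exact Hc|].
    apply (linearize_at_glb p u x Hp); intros t Ht.
    assert (Hct : 0 <= c * t) by (apply Rmult_le_pos; lra).
    assert (H := proj1 (linearize_at_glb p u (scal c x) Hp) (c * t) Hct).
    change (c * t) with (mult (c : R_Ring) t) in H at 1.
    rewrite -scal_assoc -scal_distr_l in H.
    rewrite (sublinear_scal _ _ _ Hp (Rlt_le _ _ Hc)) in H.
    apply Rinv_mult_le; lra.
Qed.

(** Zorn's lemma for the sublinear functionals below [p], ordered downwards so that maximal means
    pointwise smallest. A nonempty chain is bounded by its pointwise infimum, finite because every
    member is at least [- p (opp x)] at [x]. *)
Lemma exists_minimal_sublinear (p : E -> R) : sublinear p ->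
  exists q, sublinear q /\ (forall x, q x <= p x) /\
    forall q', sublinear q' -> (forall x, q' x <= q x) ->
      forall x, q x <= q' x.
Proof.
  intros Hp.
  pose (T := {q : E -> R | sublinear q /\ forall x, q x <= p x}).
  pose (below := fun q q' : T => forall x, proj1_sig q' x <= proj1_sig q x).
  pose (t0 := exist _ p (conj Hp (fun x => Rle_refl (p x))) : T).
  destruct (@classical_sets.ZL_preorder T t0 (fun q q' => boolp.asbool (below q q')))
    as [[q [Hq Hqp]] Hmax].
  - intros q; apply boolp.asboolT; intros x; apply Rle_refl.
  - intros q r s H1 H2.
    apply boolp.asboolW in H1.
    apply boolp.asboolW in H2.
    apply boolp.asboolT; intros x.
    eapply Rle_trans; [apply H2|apply H1].
  - intros A HA.
    assert (Htot : forall q q', A q -> A q' -> below q q' \/ below q' q).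
    { intros q q' Hq Hq'; destruct (HA q q' Hq Hq') as [H|H];
        apply boolp.asboolW in H; auto. }
    clear HA.
    destruct (Classical_Prop.classic (exists q, A q)) as [[q0 Hq0]|HA].
    (* The empty chain has no pointwise infimum; [p] itself bounds it. *)
    2: { exists t0; intros s Hs; exfalso; apply HA; now exists s. }
    pose (m := fun x => real (Glb_Rbar (fun r => exists q, A q /\ r = proj1_sig q x))).
    assert (Hm : forall x, (forall q, A q -> m x <= proj1_sig q x) /\
      (forall b, (forall q, A q -> b <= proj1_sig q x) -> b <= m x)).
    { intros x.
      destruct (real_Glb_is_glb (fun r => exists q, A q /\ r = proj1_sig q x)
        (- p (opp x))) as [H1 H2].
      - now exists (proj1_sig q0 x), q0.
      - intros r [[q [Hq Hqp]] [_ ->]]; simpl.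
        assert (H := sublinear_opp _ x Hq); specialize (Hqp (opp x)); lra.
      - split.
        + intros q Hq; apply H1; now exists q.
        + intros b Hb; apply H2; intros r [q [Hq ->]]; auto. }
    assert (Hmp : sublinear m /\ forall x, m x <= p x).
    { split; [split|].
      - intros x y.
        enough (m (plus x y) - m y <= m x) by lra.
        apply Hm; intros q Hq.
        enough (m (plus x y) - proj1_sig q x <= m y) by lra.
        apply Hm; intros q' Hq'.
        (* The smaller of [q] and [q'] lies in the chain, and its subadditivity bounds
           [m (plus x y)] by [q x + q' y]. *)
        enough (exists r, A r /\ below q r /\ below q' r) as [r [Hr [H1 H2]]].
        { assert (H := proj1 (Hm (plus x y)) r Hr).
          assert (H' := proj1 (proj1 (proj2_sig r)) x y).
          specialize (H1 x); specialize (H2 y); lra. }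
        destruct (Htot q q' Hq Hq') as [H|H]; [exists q'|exists q];
          repeat split; auto; intros z; apply Rle_refl.
      - intros c x Hc.
        apply Rinv_mult_le; [exact Hc|].
        apply Hm; intros q Hq.
        assert (H := proj1 (Hm (scal c x)) q Hq).
        rewrite (sublinear_scal _ _ _ (proj1 (proj2_sig q)) (Rlt_le _ _ Hc)) in H.
        apply Rinv_mult_le; lra.
      - intros x; apply Rle_trans with (1 := proj1 (Hm x) q0 Hq0); apply (proj2_sig q0). }
    exists (exist _ m Hmp : T); intros q Hq.
    apply boolp.asboolT; intros x; exact (proj1 (Hm x) q Hq).
  - exists q; split; [exact Hq|split; [exact Hqp|]].
    intros q' Hq' Hle x.
    assert (Hq'p : forall x, q' x <= p x)
      by (intros z; eapply Rle_trans; [apply Hle|apply Hqp]).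
    assert (H := Hmax (exist _ q' (conj Hq' Hq'p) : T)
                   (boolp.asboolT Hle)).
    apply boolp.asboolW in H; apply H.
Qed.

(** Let [q] be minimal below [linearize_at p u]. Minimality against [linearize_at q x] gives
    [q (opp x) <= - q x], so [q] is odd, and an odd sublinear functional is linear. Linearizing at
    [u] first gives [q (opp u) <= - p u], hence [q u = p u]. *)
Lemma hahn_banach (p : E -> R) (u : E) : sublinear p ->
  exists q : E -> R,
    (forall x y, q (plus x y) = q x + q y) /\
    (forall c x, q (scal c x) = c * q x) /\
    (forall x, q x <= p x) /\ q u = p u.
Proof.
  intros Hp.
  destruct (exists_minimal_sublinear _ (linearize_at_sublinear p u Hp))
    as [q [Hq [Hle Hmin]]].
  assert (Hopp : forall x, q (opp x) = - q x).
  { intros x; apply Rle_antisym.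
    - eapply Rle_trans; [apply Hmin|now apply (linearize_at_opp q x)].
      + now apply linearize_at_sublinear.
      + intros z; now apply linearize_at_le.
    - assert (H := sublinear_opp q x Hq); lra. }
  exists q; split; [|split; [|split]].
  - intros x y; apply Rle_antisym; [apply Hq|].
    assert (H : q (opp (plus x y)) <= q (opp x) + q (opp y))
      by (rewrite opp_plus; apply Hq).
    rewrite !Hopp in H; lra.
  - intros c x; destruct (Rle_dec 0 c) as [Hc|Hc].
    + now apply sublinear_scal.
    + replace (scal c x) with (opp (scal (- c) x)).
      * rewrite Hopp sublinear_scal; auto; lra.
      * change (- c) with (opp (c : R_Ring)).
        now rewrite scal_opp_l opp_opp.
  - intros x; eapply Rle_trans; [apply Hle|now apply linearize_at_le].
  - apply Rle_antisym.
    + eapply Rle_trans; [apply Hle|now apply linearize_at_le].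
    + assert (H := Hle (opp u)).
      assert (H' := linearize_at_opp p u Hp).
      rewrite Hopp in H; lra.
Qed.

End HahnBanach.

(** * Real scalars inside [K], and norming functionals over the reals and the complex numbers *)

(** Abstracts the inclusion of the reals in [K], so that both fields are treated at once.
    Multiplication in an [AbsRing] need not commute, hence the field [emb_central]. *)
Record is_real_embedding {K : AbsRing} (emb : R -> K) : Prop := RealEmbedding {
  emb_one : emb 1 = one;
  emb_plus : forall r s, emb (r + s) = plus (emb r) (emb s);
  emb_mult : forall r s, emb (r * s) = mult (emb r) (emb s);
  emb_abs : forall r, abs (emb r) = Rabs r;
  emb_central : forall r k, mult (emb r) k = mult k (emb r)
}.

(** The inequality [norm_scal] is reversed by scaling back with [/ r]. *)
Lemma norm_scal_emb {K : AbsRing} (emb : R -> K) (V : NormedModule K)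
  (r : R) (x : V) :
  is_real_embedding emb -> norm (scal (emb r) x) = Rabs r * norm x.
Proof.
  intros He.
  assert (Hle : forall s (y : V), norm (scal (emb s) y) <= Rabs s * norm y)
    by (intros s y; rewrite -(emb_abs _ He); apply norm_scal).
  apply Rle_antisym; [apply Hle|].
  destruct (Req_dec r 0) as [->|Hr].
  - rewrite Rabs_R0 Rmult_0_l; apply norm_ge_0.
  - assert (H := Hle (/ r) (scal (emb r) x)).
    rewrite scal_assoc -(emb_mult _ He) Rinv_l // (emb_one _ He) scal_one in H.
    rewrite Rabs_inv in H.
    apply Rle_Rinv_mult in H; [exact H|now apply Rabs_pos_lt].
Qed.

Section RestrictionOfScalars.

Context {K : AbsRing} (emb : R -> K) (He : is_real_embedding emb)
  (V : NormedModule K).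

Definition real_scal (r : R) (x : V) : V := scal (emb r) x.

Lemma real_scal_assoc (r s : R_Ring) (x : V) :
  real_scal r (real_scal s x) = real_scal (mult r s) x.
Proof.
  unfold real_scal; rewrite scal_assoc -(emb_mult _ He); reflexivity.
Qed.

Lemma real_scal_one (x : V) : real_scal (one : R_Ring) x = x.
Proof.
  unfold real_scal; change (one : R_Ring) with 1.
  rewrite (emb_one _ He); apply scal_one.
Qed.

Lemma real_scal_distr_l (r : R_Ring) (x y : V) :
  real_scal r (plus x y) = plus (real_scal r x) (real_scal r y).
Proof. exact (scal_distr_l (emb r) x y). Qed.

Lemma real_scal_distr_r (r s : R_Ring) (x : V) :
  real_scal (plus r s) x = plus (real_scal r x) (real_scal s x).
Proof.
  unfold real_scal; change (plus r s) with (r + s).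
  rewrite (emb_plus _ He); exact (scal_distr_r (emb r) (emb s) x).
Qed.

Definition real_ModuleSpace : ModuleSpace R_Ring :=
  ModuleSpace.Pack R_Ring V
    (ModuleSpace.Class R_Ring V (AbelianGroup.class V)
       (ModuleSpace.Mixin R_Ring V real_scal
          real_scal_assoc real_scal_one real_scal_distr_l real_scal_distr_r)) V.

Lemma real_norming_functional (u : V) :
  exists q : V -> R,
    (forall x y, q (plus x y) = q x + q y) /\
    (forall r x, q (scal (emb r) x) = r * q x) /\
    (forall x, Rabs (q x) <= norm x) /\ q u = norm u.
Proof.
  destruct (@hahn_banach real_ModuleSpace (fun x : V => norm x) u)
    as [q [Hplus [Hscal [Hle Hu]]]].
  - split.
    + exact norm_triangle.
    + intros c x Hc.
      assert (H := norm_scal_emb emb V c x He).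
      rewrite (Rabs_pos_eq c (Rlt_le _ _ Hc)) in H; right; exact H.
  - exists q; repeat split; [exact Hplus|exact Hscal| |exact Hu].
    intros x; apply Rabs_le; split; [|apply Hle].
    (* The lower bound on [q x] is the upper bound at the opposite point. *)
    assert (H := Hle (real_scal (-1) x)).
    assert (H' : q (real_scal (-1) x) = -1 * q x) by exact (Hscal (-1) x).
    unfold real_scal in H, H'.
    rewrite (norm_scal_emb _ _ _ _ He) Rabs_left in H; [lra|].
    lra.
Qed.

End RestrictionOfScalars.

Definition has_norming_functionals {K : AbsRing} (emb : R -> K) : Prop :=
  forall (V : NormedModule K) (u : V), exists f : V -> K,
    (forall x y, f (plus x y) = plus (f x) (f y)) /\
    (forall k x, f (scal k x) = mult k (f x)) /\
    (forall x, abs (f x) <= norm x) /\ f u = emb (norm u).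

Lemma R_real_embedding : is_real_embedding (fun r : R => r : R_AbsRing).
Proof. split; try easy; exact Rmult_comm. Qed.

Lemma R_norming_functionals :
  has_norming_functionals (fun r : R => r : R_AbsRing).
Proof.
  intros V u.
  exact (real_norming_functional _ R_real_embedding V u).
Qed.

Lemma C_real_embedding : is_real_embedding (RtoC : R -> C_AbsRing).
Proof.
  split.
  - reflexivity.
  - exact RtoC_plus.
  - exact RtoC_mult.
  - exact Cmod_R.
  - intros r; exact (Cmult_comm r).
Qed.

Lemma Cmod_sqr (z : C) : Cmod z * Cmod z = fst z * fst z + snd z * snd z.
Proof.
  unfold Cmod; rewrite sqrt_sqrt; [simpl; ring|].
  apply Rplus_le_le_0_compat; apply pow2_ge_0.
Qed.

(** Complexification in the manner of Bohnenblust and Sobczyk: [q] is the real part of the complex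
    linear [f x = q x - i q (i x)]. As [f u] has real part [norm u] and modulus at most [norm u],
    its imaginary part vanishes. *)
Lemma C_norming_functionals :
  has_norming_functionals (RtoC : R -> C_AbsRing).
Proof.
  intros V u.
  destruct (real_norming_functional _ C_real_embedding V u)
    as [q [Hplus [Hscal [Hle Hu]]]].
  pose (f := fun x : V => (q x, - q (scal (Ci : C_AbsRing) x)) : C_AbsRing).
  assert (Hdec : forall (k : C) (x : V), q (scal (k : C_AbsRing) x) =
            fst k * q x + snd k * q (scal (Ci : C_AbsRing) x)).
  { intros [a b] x; simpl.
    rewrite -!Hscal -Hplus scal_assoc -scal_distr_r.
    apply (f_equal (fun k : C_AbsRing => q (scal k x))).
    apply injective_projections; simpl;
      unfold mult, plus; simpl; ring. }
  assert (Hfscal : forall (k : C_AbsRing) x, f (scal k x) = mult k (f x)).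
  { intros k x; unfold f.
    rewrite scal_assoc (Hdec k x) (Hdec (mult (Ci : C_AbsRing) k) x).
    destruct k as [a b]; apply injective_projections; simpl; ring. }
  assert (Hfle : forall x, Cmod (f x) <= norm x).
  { intros x; destruct (Req_dec (Cmod (f x)) 0) as [->|Hz];
      [apply norm_ge_0|].
    (* Rotate [x] by a unit scalar that makes [f x] real and nonnegative. *)
    pose (c := (fst (f x) / Cmod (f x), - snd (f x) / Cmod (f x)) : C).
    assert (Hm := Cmod_sqr (f x)).
    assert (Hc : Cmod c = 1).
    { apply Rsqr_inj; [apply Cmod_ge_0|lra|]; unfold Rsqr.
      rewrite Cmod_sqr.
      change (fst c) with (fst (f x) / Cmod (f x)).
      change (snd c) with (- snd (f x) / Cmod (f x)).
      transitivity ((fst (f x) * fst (f x) + snd (f x) * snd (f x))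
        / (Cmod (f x) * Cmod (f x))); [field; exact Hz|].
      rewrite -Hm; field; exact Hz. }
    assert (Hq : q (scal (c : C_AbsRing) x) = Cmod (f x)).
    { rewrite Hdec; apply Rmult_eq_reg_r with (Cmod (f x)); [|exact Hz].
      rewrite Hm.
      change (fst c) with (q x / Cmod (f x)).
      change (snd c) with (- - q (scal (Ci : C_AbsRing) x) / Cmod (f x)).
      change (fst (f x)) with (q x).
      change (snd (f x)) with (- q (scal (Ci : C_AbsRing) x)).
      field; exact Hz. }
    rewrite -Hq.
    apply Rle_trans with (1 := Rle_abs _), Rle_trans with (1 := Hle _).
    apply Rle_trans with (1 := norm_scal _ _).
    change (abs (c : C_AbsRing)) with (Cmod c); rewrite Hc; lra. }
  exists f; repeat split.
  - intros x y; unfold f.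
    rewrite scal_distr_l !Hplus.
    apply injective_projections; simpl; ring.
  - exact Hfscal.
  - exact Hfle.
  - assert (H := Cmod_sqr (f u)).
    assert (H' := Hfle u); assert (H0 := Cmod_ge_0 (f u)).
    assert (Hs : snd (f u) = 0) by (simpl fst in H; rewrite Hu in H; nra).
    apply injective_projections; [exact Hu|exact Hs].
Qed.

Lemma exists_real_embedding (K : AbsRing) : K = R_AbsRing \/ K = C_AbsRing ->
  exists emb : R -> K, is_real_embedding emb /\ has_norming_functionals emb.
Proof.
  intros [->| ->].
  - eexists; split; [exact R_real_embedding|exact R_norming_functionals].
  - eexists; split; [exact C_real_embedding|exact C_norming_functionals].
Qed.

(** * Operator norms and quasi norm attainment *)

Section OperatorNorm.

Context {K : AbsRing} {X Y : NormedModule K}.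

Lemma is_linear_minus (S T : X -> Y) :
  is_linear S -> is_linear T -> is_linear (fun x => minus (T x) (S x)).
Proof.
  intros HS HT.
  destruct (linear_norm _ HS) as [MS [HMS HbS]].
  destruct (linear_norm _ HT) as [MT [HMT HbT]].
  split.
  - intros x y; rewrite (linear_plus _ HS) (linear_plus _ HT).
    unfold minus; rewrite opp_plus -!plus_assoc; f_equal.
    rewrite !plus_assoc; f_equal; apply plus_comm.
  - intros k x; rewrite (linear_scal _ HS) (linear_scal _ HT).
    unfold minus; rewrite scal_distr_l scal_opp_r; reflexivity.
  - exists (MT + MS); split; [lra|]; intros x.
    apply Rle_trans with (1 := norm_triangle _ _); rewrite norm_opp.
    specialize (HbS x); specialize (HbT x); lra.
Qed.

Lemma linear_minus (T : X -> Y) (x y : X) :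
  is_linear T -> T (minus x y) = minus (T x) (T y).
Proof.
  intros HT; unfold minus.
  rewrite (linear_plus _ HT) -scal_opp_one (linear_scal _ HT) scal_opp_one.
  reflexivity.
Qed.

Lemma linear_zero (T : X -> Y) : is_linear T -> T zero = zero.
Proof.
  intros HT.
  transitivity (T (minus zero zero)); [now rewrite minus_eq_zero|].
  rewrite (linear_minus _ _ _ HT); exact (minus_eq_zero (T zero)).
Qed.

Lemma norm_le_op_norm (T : X -> Y) (x : X) :
  is_linear T -> norm x <= 1 -> norm (T x) <= op_norm T.
Proof.
  intros HT Hx; destruct (linear_norm _ HT) as [M [HM Hb]].
  apply (real_Lub_is_lub
    (fun r => exists x : X, norm x <= 1 /\ r = norm (T x)) M);
    [now exists (norm (T x)), x| |now exists x].
  intros r [y [Hy ->]]; specialize (Hb y); nra.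
Qed.

Lemma op_norm_le (T : X -> Y) (M : R) :
  (forall x, norm x <= 1 -> norm (T x) <= M) -> op_norm T <= M.
Proof.
  intros HT; apply (real_Lub_is_lub
    (fun r => exists x : X, norm x <= 1 /\ r = norm (T x)) M).
  - exists (norm (T zero)), zero; split; [rewrite norm_zero; lra|reflexivity].
  - intros r [x [Hx ->]]; auto.
  - intros r [x [Hx ->]]; auto.
Qed.

Lemma op_norm_ge_0 (T : X -> Y) : is_linear T -> 0 <= op_norm T.
Proof.
  intros HT; apply Rle_trans with (norm (T zero)); [apply norm_ge_0|].
  apply norm_le_op_norm; [exact HT|rewrite norm_zero; lra].
Qed.

Lemma norm_le_op_norm_mult (emb : R -> K) (T : X -> Y) (x : X) :
  is_real_embedding emb -> is_linear T -> norm (T x) <= op_norm T * norm x.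
Proof.
  intros He HT; destruct (Req_dec (norm x) 0) as [Hx|Hx].
  - destruct (linear_norm _ HT) as [M [HM Hb]].
    specialize (Hb x); rewrite Hx in Hb |- *; lra.
  - assert (Hp : 0 < norm x) by (assert (H := norm_ge_0 x); lra).
    assert (H := norm_le_op_norm T (scal (emb (/ norm x)) x) HT).
    rewrite (linear_scal _ HT) !(norm_scal_emb _ _ _ _ He) in H.
    rewrite Rabs_inv Rabs_pos_eq in H; [|lra].
    rewrite Rinv_l in H; [|exact Hx].
    specialize (H (Rle_refl 1)).
    apply Rinv_mult_le in H; lra.
Qed.

Lemma in_norm_closure_norm_le (A : Y -> Prop) (u : Y) (M : R) :
  in_norm_closure A u -> (forall y, A y -> norm y <= M) -> norm u <= M.
Proof.
  intros Hu HM; apply le_epsilon; intros e He.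
  destruct (Hu (mkposreal e He)) as [y [Hy Hyu]]; simpl in Hyu.
  assert (H := norm_triangle_inv y u); apply Rabs_le_between in H.
  specialize (HM y Hy); lra.
Qed.

(** A limit of values on the unit ball has norm at most [op_norm T], so a pointwise bound by
    [norm u] already forces equality. *)
Lemma QNA_intro (T : X -> Y) (u : Y) :
  is_linear T -> (forall x, norm (T x) <= norm u * norm x) ->
  in_norm_closure (image_unit_ball T) u -> QNA T.
Proof.
  intros HT Hle Hu; split; [exact HT|exists u; split; [exact Hu|]].
  apply Rle_antisym.
  - apply in_norm_closure_norm_le with (1 := Hu).
    intros y [x [Hx ->]]; now apply norm_le_op_norm.
  - apply op_norm_le; intros x Hx.
    apply Rle_trans with (1 := Hle x).
    assert (H := norm_ge_0 u); assert (H' := norm_ge_0 x); nra.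
Qed.

(** An operator of norm 0 quasi attains it at [zero] and approximates itself. Elsewhere [eps / 2]
    turns the non-strict pointwise estimate into the strict one. Positivity of [op_norm S] is what
    the later choices of tolerance rely on. *)
Lemma QNA_dense_intro :
  (forall S : X -> Y, is_linear S -> 0 < op_norm S ->
     forall eps, 0 < eps -> exists T : X -> Y, QNA T /\
       forall x, norm x <= 1 -> norm (minus (T x) (S x)) <= eps) ->
  QNA_dense X Y.
Proof.
  intros H S HS [eps Heps]; simpl.
  destruct (op_norm_ge_0 S HS) as [Hpos|H0].
  - destruct (H S HS Hpos (eps / 2)) as [T [HT Hle]]; [lra|].
    exists T; split; [exact HT|].
    assert (Hn := op_norm_le _ _ Hle); lra.
  - exists S; split.
    + split; [exact HS|exists zero; split; [|now rewrite norm_zero]].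
      intros e; exists zero; split.
      * exists zero; split; [rewrite norm_zero; lra|].
        symmetry; exact (linear_zero S HS).
      * rewrite minus_eq_zero norm_zero; apply cond_pos.
    + apply Rle_lt_trans with 0; [|exact Heps].
      apply op_norm_le; intros x _; rewrite minus_eq_zero norm_zero; lra.
Qed.

(** Density in working form: [norm u] stands for [op_norm T], and estimates are pointwise. The last
    clause keeps [u] away from 0 once [d] is small against [op_norm S]. *)
Lemma QNA_dense_approx (emb : R -> K) : is_real_embedding emb ->
  QNA_dense X Y -> forall S : X -> Y, is_linear S ->
  forall d, 0 < d -> exists (T : X -> Y) (u : Y),
    is_linear T /\ (forall x, norm (T x) <= norm u * norm x) /\
    in_norm_closure (image_unit_ball T) u /\
    (forall x, norm (minus (T x) (S x)) <= d * norm x) /\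
    op_norm S <= norm u + d.
Proof.
  intros He Hd S HS d Hpos.
  destruct (Hd S HS (mkposreal d Hpos)) as [T [[HT [u [Hu Hnu]]] Hlt]].
  simpl in Hlt; exists T, u.
  assert (Hle : forall x, norm (minus (T x) (S x)) <= d * norm x).
  { intros x.
    apply Rle_trans with
      (1 := norm_le_op_norm_mult _ _ x He (is_linear_minus _ _ HS HT)).
    apply Rmult_le_compat_r; [apply norm_ge_0|lra]. }
  split; [exact HT|split; [|split; [exact Hu|split; [exact Hle|]]]].
  - intros x; rewrite Hnu; exact (norm_le_op_norm_mult _ _ x He HT).
  - apply op_norm_le; intros x Hx.
    assert (H := norm_le_op_norm T x HT Hx).
    assert (H1 := norm_triangle_inv (T x) (S x)); apply Rabs_le_between in H1.
    specialize (Hle x); assert (H2 := norm_ge_0 x); nra.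
Qed.

End OperatorNorm.

(** * Absolute norms on the plane *)

Section AbsoluteNorm.

Context (N : R * R -> R) (HN : is_absolute_norm N).

Lemma absolute_norm_fst (s : R) : N (s, 0) = Rabs s.
Proof.
  assert (H := absolute_norm_scal HN s (1, 0)).
  rewrite (absolute_norm_10 HN) in H.
  replace (scal s (1, 0)) with ((s, 0) : R * R) in H; [lra|].
  apply injective_projections; symmetry;
    [exact (Rmult_1_r s)|exact (Rmult_0_r s)].
Qed.

Lemma absolute_norm_snd (t : R) : N (0, t) = Rabs t.
Proof.
  assert (H := absolute_norm_scal HN t (0, 1)).
  rewrite (absolute_norm_01 HN) in H.
  replace (scal t (0, 1)) with ((0, t) : R * R) in H; [lra|].
  apply injective_projections; symmetry;
    [exact (Rmult_0_r t)|exact (Rmult_1_r t)].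
Qed.

Lemma absolute_norm_sum (a b c d : R) :
  N (a + c, b + d) <= N (a, b) + N (c, d).
Proof. exact (absolute_norm_triangle HN (a, b) (c, d)). Qed.

(** The points [(s, t)] and [(s, - t)] have equal norm and add up to [(2 s, 0)]. *)
Lemma absolute_norm_ge_fst (s t : R) : Rabs s <= N (s, t).
Proof.
  assert (H := absolute_norm_sum s t s (- t)).
  rewrite (absolute_norm_abs HN s (- t)) Rabs_Ropp -(absolute_norm_abs HN s t) in H.
  rewrite Rplus_opp_r absolute_norm_fst in H.
  replace (s + s) with (2 * s) in H by ring.
  rewrite Rabs_mult (Rabs_pos_eq 2) in H; lra.
Qed.

Lemma absolute_norm_ge_snd (s t : R) : Rabs t <= N (s, t).
Proof.
  assert (H := absolute_norm_sum s t (- s) t).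
  rewrite (absolute_norm_abs HN (- s) t) Rabs_Ropp -(absolute_norm_abs HN s t) in H.
  rewrite Rplus_opp_r absolute_norm_snd in H.
  replace (t + t) with (2 * t) in H by ring.
  rewrite Rabs_mult (Rabs_pos_eq 2) in H; lra.
Qed.

(** Take a Hahn-Banach functional norming [(s, t)] and replace its coefficients by their absolute
    values. As [N] ignores signs, it stays below [N] on the positive quadrant, and its value at
    [(s, t)] does not decrease. Evaluation at the unit vectors bounds the coefficients by 1. *)
Lemma absolute_norm_norming (s t : R) : 0 <= s -> 0 <= t ->
  exists a b, 0 <= a <= 1 /\ 0 <= b <= 1 /\ N (s, t) <= a * s + b * t /\
    forall x y, 0 <= x -> 0 <= y -> a * x + b * y <= N (x, y).
Proof.
  intros Hs Ht.
  destruct (@hahn_banach (prod_ModuleSpace R_Ring R_ModuleSpace R_ModuleSpace)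
    N (s, t)) as [q [Hplus [Hscal [Hle Heq]]]].
  { split; [exact (absolute_norm_triangle HN)|].
    intros c x Hc; right.
    rewrite -{2}(Rabs_pos_eq c (Rlt_le _ _ Hc)).
    exact (absolute_norm_scal HN c x). }
  assert (Hq : forall x y : R, q (x, y) = x * q (1, 0) + y * q (0, 1)).
  { intros x y; rewrite -!Hscal -Hplus; f_equal.
    apply injective_projections.
    - change (x = x * 1 + y * 0 :> R); ring.
    - change (y = x * 0 + y * 1 :> R); ring. }
  assert (Hab : forall x y, 0 <= x -> 0 <= y ->
    Rabs (q (1, 0)) * x + Rabs (q (0, 1)) * y <= N (x, y)).
  { intros x y Hx Hy.
    assert (Hsign : forall c z, 0 <= z ->
      exists z', Rabs z' = Rabs z /\ z' * c = Rabs c * z).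
    { intros c z Hz; destruct (Rle_dec 0 c) as [Hc|Hc].
      - exists z; rewrite (Rabs_pos_eq c) //; split; [reflexivity|ring].
      - exists (- z); rewrite Rabs_Ropp (Rabs_left1 c); [|lra].
        split; [reflexivity|ring]. }
    destruct (Hsign (q (1, 0)) x Hx) as [x' [Hx' <-]].
    destruct (Hsign (q (0, 1)) y Hy) as [y' [Hy' <-]].
    rewrite (absolute_norm_abs HN x y) -Hx' -Hy' -(absolute_norm_abs HN) -Hq.
    apply Hle. }
  exists (Rabs (q (1, 0))), (Rabs (q (0, 1))).
  assert (H1 := Hab 1 0 Rle_0_1 (Rle_refl 0)).
  assert (H2 := Hab 0 1 (Rle_refl 0) Rle_0_1).
  rewrite (absolute_norm_10 HN) in H1.
  rewrite (absolute_norm_01 HN) in H2.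
  split; [split; [apply Rabs_pos|lra]|].
  split; [split; [apply Rabs_pos|lra]|].
  split; [|exact Hab].
  rewrite -Heq Hq.
  assert (H3 := Rle_abs (q (1, 0))); assert (H4 := Rle_abs (q (0, 1))); nra.
Qed.

Lemma absolute_norm_pos (p : R * R) : p <> (0, 0) -> 0 < N p.
Proof.
  intros Hp; destruct p as [s t].
  destruct (Rle_lt_or_eq_dec 0 (N (s, t))) as [H|H]; [|exact H|].
  - apply Rle_trans with (Rabs s); [apply Rabs_pos|apply absolute_norm_ge_fst].
  - exfalso; apply Hp; exact (absolute_norm_definite HN (eq_sym H)).
Qed.

(** The supremum is tested at [p / N p]; it is finite because [N] dominates both coordinates. *)
Lemma pairing_le_dual_norm (f p : R * R) :
  Rabs (pairing f p) <= dual_norm N f * N p.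
Proof.
  destruct (Classical_Prop.classic (p = (0, 0))) as [->|Hp].
  - unfold pairing; simpl; rewrite !Rmult_0_r Rplus_0_r Rabs_R0.
    rewrite absolute_norm_fst Rabs_R0; lra.
  - apply absolute_norm_pos in Hp.
    assert (Hi : Rabs (/ N p) = / N p)
      by (apply Rabs_pos_eq; left; now apply Rinv_0_lt_compat).
    assert (Hp' : N (scal (/ N p) p) = 1)
      by (rewrite (absolute_norm_scal HN) Hi; field; lra).
    assert (H : / N p * Rabs (pairing f p) <= dual_norm N f).
    { apply (real_Lub_is_lub
        (fun r => exists p : R * R, N p <= 1 /\ r = Rabs (pairing f p))
        (Rabs (fst f) + Rabs (snd f))).
      - exists (Rabs (pairing f (scal (/ N p) p))), (scal (/ N p) p); lra.
      - intros r [[s t] [Hst ->]]; unfold pairing; simpl.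
        apply Rle_trans with (1 := Rabs_triang _ _); rewrite !Rabs_mult.
        assert (H1 := absolute_norm_ge_fst s t).
        assert (H2 := absolute_norm_ge_snd s t).
        assert (H3 := Rabs_pos (fst f)); assert (H4 := Rabs_pos (snd f)).
        apply Rplus_le_compat; nra.
      - exists (scal (/ N p) p); split; [lra|].
        rewrite -{1}Hi -Rabs_mult; f_equal; unfold pairing.
        change (/ N p * (fst f * fst p + snd f * snd p) =
          fst f * (/ N p * fst p) + snd f * (/ N p * snd p)); ring. }
    apply Rinv_mult_le in H; lra.
Qed.

(** A norm-one functional with value 1 at [(1, 0)] that separates [(0, 1)] from the origin is
    [(1, f2)] with [f2 <> 0]; take [c = Rabs f2]. Depending on the sign of [f2], the bound comes
    from [(Rabs s, Rabs t)] or [(Rabs s, - Rabs t)]. *)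
Lemma type1_lower_bound : is_type1 N ->
  exists c, 0 < c /\ forall s t, Rabs s + c * Rabs t <= N (s, t).
Proof.
  intros [_ Hv].
  destruct (Hv (0, 1) (0, 0)) as [[f1 f2] [Hf [Hf1 Hf2]]].
  { intros H; injection H; lra. }
  unfold pairing in Hf1, Hf2; simpl in Hf1, Hf2.
  exists (Rabs f2); split; [apply Rabs_pos_lt; intros H; apply Hf2; lra|].
  intros s t.
  rewrite (absolute_norm_abs HN).
  assert (H1 := pairing_le_dual_norm (f1, f2) (Rabs s, Rabs t)).
  assert (H2 := pairing_le_dual_norm (f1, f2) (Rabs s, - Rabs t)).
  rewrite (absolute_norm_abs HN (Rabs s) (- Rabs t)) Rabs_Ropp in H2.
  rewrite -(absolute_norm_abs HN (Rabs s) (Rabs t)) in H2.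
  rewrite Hf in H1; rewrite Hf in H2.
  unfold pairing in H1, H2; simpl in H1, H2.
  apply Rabs_le_between in H1; apply Rabs_le_between in H2.
  assert (E1 : f1 = 1) by lra; rewrite E1 in H1 H2.
  destruct (Rle_dec 0 f2) as [Hp|Hp].
  - rewrite (Rabs_pos_eq f2 Hp); lra.
  - rewrite (Rabs_left1 f2); lra.
Qed.

End AbsoluteNorm.

Lemma norm_l1_absolute : is_absolute_norm norm_l1.
Proof.
  split; unfold norm_l1.
  - intros p q; simpl.
    assert (H1 := Rabs_triang (fst p) (fst q)).
    assert (H2 := Rabs_triang (snd p) (snd q)).
    unfold plus; simpl; lra.
  - intros c p; simpl; unfold scal; simpl; unfold mult; simpl.
    rewrite !Rabs_mult; ring.
  - intros [s t]; simpl; intros H.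
    assert (H1 := Rabs_pos s); assert (H2 := Rabs_pos t).
    apply injective_projections; simpl; apply Rabs_eq_0; lra.
  - simpl; rewrite Rabs_R0 Rabs_R1; lra.
  - simpl; rewrite Rabs_R0 Rabs_R1; lra.
  - intros s t; simpl; now rewrite !Rabs_Rabsolu.
Qed.

(** * Projections of an absolute sum *)

Section AbsoluteSum.

Context {K : AbsRing} {X : NormedModule K}.

Lemma is_linear_inclusion (W : closed_subspace X) :
  is_linear (fun x : subspace W => proj1_sig x : X).
Proof.
  split; [reflexivity|reflexivity|].
  exists 1; split; [lra|]; intros x.
  change (norm x) with (norm (proj1_sig x)); lra.
Qed.

(** Choice picks the components, uniqueness of the decomposition makes them linear, and they are
    bounded by 1 because [N] dominates each coordinate. *)
Lemma absolute_sum_projections (N : R * R -> R) (X1 X2 : closed_subspace X) :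
  is_absolute_norm N -> is_absolute_sum N X1 X2 ->
  exists (P1 : X -> subspace X1) (P2 : X -> subspace X2),
    is_linear P1 /\ is_linear P2 /\
    (forall x, x = plus (proj1_sig (P1 x)) (proj1_sig (P2 x))) /\
    (forall x, norm x = N (norm (P1 x), norm (P2 x))) /\
    (forall x1 : subspace X1, P1 (proj1_sig x1) = x1) /\
    (forall x1 : subspace X1, P2 (proj1_sig x1) = zero) /\
    (forall x2 : subspace X2, P1 (proj1_sig x2) = zero).
Proof.
  intros HN [Hdec Hnorm].
  destruct (functional_choice
    (fun (x : X) (p : subspace X1 * subspace X2) =>
       x = plus (proj1_sig (fst p)) (proj1_sig (snd p)))) as [P HP].
  { intros x; destruct (Hdec x) as [p [Hp _]]; now exists p. }
  assert (Huniq : forall x (x1 : subspace X1) (x2 : subspace X2),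
    x = plus (proj1_sig x1) (proj1_sig x2) -> P x = (x1, x2)).
  { intros x x1 x2 Hx; destruct (Hdec x) as [p [_ Hp]].
    rewrite -(Hp (P x) (HP x)); now apply Hp. }
  assert (HPplus : forall x y, P (plus x y) =
    (plus (fst (P x)) (fst (P y)), plus (snd (P x)) (snd (P y)))).
  { intros x y; apply Huniq; simpl.
    rewrite {1}(HP x) {1}(HP y) -!plus_assoc; f_equal.
    rewrite !plus_assoc; f_equal; apply plus_comm. }
  assert (HPscal : forall k x, P (scal k x) =
    (scal k (fst (P x)), scal k (snd (P x)))).
  { intros k x; apply Huniq; simpl.
    rewrite {1}(HP x).
    exact (scal_distr_l k (proj1_sig (fst (P x))) (proj1_sig (snd (P x)))). }
  assert (HPnorm : forall x, norm x = N (norm (fst (P x)), norm (snd (P x)))).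
  { intros x; rewrite {1}(HP x); apply Hnorm. }
  assert (HPin : forall x1 : subspace X1, P (proj1_sig x1) = (x1, zero)).
  { intros x1; apply Huniq; symmetry; exact (plus_zero_r (proj1_sig x1)). }
  assert (HPin2 : forall x2 : subspace X2, P (proj1_sig x2) = (zero, x2)).
  { intros x2; apply Huniq; symmetry; exact (plus_zero_l (proj1_sig x2)). }
  exists (fun x => fst (P x)), (fun x => snd (P x)).
  split; [|split; [|split; [exact HP|split; [exact HPnorm|]]]].
  - split.
    + intros x y; now rewrite HPplus.
    + intros k x; now rewrite HPscal.
    + exists 1; split; [lra|]; intros x; rewrite (HPnorm x) Rmult_1_l.
      apply Rle_trans with (1 := Rle_abs _), absolute_norm_ge_fst, HN.
  - split.
    + intros x y; now rewrite HPplus.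
    + intros k x; now rewrite HPscal.
    + exists 1; split; [lra|]; intros x; rewrite (HPnorm x) Rmult_1_l.
      apply Rle_trans with (1 := Rle_abs _), absolute_norm_ge_snd, HN.
  - split; [|split]; intros z; now rewrite ?HPin ?HPin2.
Qed.

End AbsoluteSum.

(** * Summands of the domain *)

Lemma QNA_dense_domain_summand {K : AbsRing} (emb : R -> K)
  (X Y : NormedModule K) (N : R * R -> R) (c : R) (X1 X2 : closed_subspace X) :
  is_real_embedding emb -> is_absolute_norm N -> is_absolute_sum N X1 X2 ->
  0 < c -> (forall s t, Rabs s + c * Rabs t <= N (s, t)) ->
  QNA_dense X Y -> QNA_dense (subspace X1) Y.
Proof.
  intros He HN Hsum Hc HcN Hd.
  destruct (absolute_sum_projections N X1 X2 HN Hsum)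
    as [P1 [P2 [HP1 [HP2 [Hdec [Hnorm [HP11 [HP21 HP12]]]]]]]].
  apply QNA_dense_intro; intros S HS Hpos eps Heps.
  (* The second term ensures [d * (1 + c) < c * op_norm S]; with [op_norm S <= norm u + d] this
     makes the gap [c * norm u - d] positive. *)
  pose (d := Rmin eps (c * op_norm S / (2 * (1 + c)))).
  assert (Hcl : 0 < c * op_norm S / (2 * (1 + c)))
    by (apply Rdiv_lt_0_compat; nra).
  assert (Hd0 : 0 < d) by (now apply Rmin_glb_lt).
  assert (Hdeps : d <= eps) by apply Rmin_l.
  assert (Hdl : d * (1 + c) < c * op_norm S).
  { apply Rle_lt_trans with (c * op_norm S / (2 * (1 + c)) * (1 + c)).
    - apply Rmult_le_compat_r; [lra|apply Rmin_r].
    - replace (c * op_norm S / (2 * (1 + c)) * (1 + c))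
        with (c * op_norm S / 2) by (field; lra); nra. }
  assert (HS' : is_linear (fun x => S (P1 x))) by (now apply is_linear_comp).
  destruct (QNA_dense_approx emb He Hd _ HS' d Hd0)
    as [T [u [HT [HTle [Hu [HTS HSu]]]]]].
  assert (HSS : op_norm S <= op_norm (fun x => S (P1 x))).
  { apply op_norm_le; intros x Hx.
    rewrite -{1}(HP11 x).
    exact (norm_le_op_norm (fun x => S (P1 x)) (proj1_sig x) HS' Hx). }
  assert (Hg : 0 < c * norm u - d) by nra.
  exists (fun x1 : subspace X1 => T (proj1_sig x1)); split.
  - apply QNA_intro with u.
    + exact (is_linear_comp _ _ (is_linear_inclusion X1) HT).
    + intros x; exact (HTle (proj1_sig x)).
    + intros [e Hepos]; simpl.
      (* Here [h] will bound [norm (P2 x)]. With [T x] within [h * (c * norm u - d)] of [u] and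
         [T (P2 x)] of norm at most [d * h], the errors add up to [h * (c * norm u) = e]. *)
      pose (h := e / (c * norm u)).
      assert (Hh : 0 < h) by (apply Rdiv_lt_0_compat; lra).
      assert (Hhe : h * (c * norm u) = e) by (unfold h; field; nra).
      destruct (Hu (mkposreal (h * (c * norm u - d)) (Rmult_lt_0_compat _ _ Hh Hg)))
        as [y [[x [Hx ->]] Hxu]]; simpl in Hxu.
      assert (Hx12 := HcN (norm (P1 x)) (norm (P2 x))).
      rewrite -Hnorm !Rabs_pos_eq in Hx12; try apply norm_ge_0.
      assert (H1 := norm_ge_0 (P1 x)); assert (H2 := norm_ge_0 (P2 x)).
      assert (HTx : T x = plus (T (proj1_sig (P1 x))) (T (proj1_sig (P2 x))))
        by (rewrite {1}(Hdec x); apply (linear_plus _ HT)).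
      assert (HT1 := HTle (proj1_sig (P1 x))).
      change (norm (proj1_sig (P1 x))) with (norm (P1 x)) in HT1.
      (* The extension of [S] vanishes on [X2], so there [T] is its own error. *)
      assert (HT2 : norm (T (proj1_sig (P2 x))) <= d * norm (P2 x)).
      { assert (H := HTS (proj1_sig (P2 x))).
        rewrite HP12 (linear_zero S HS) minus_zero_r in H; exact H. }
      (* [T x] has norm above [norm u - h * (c * norm u - d)] and at most [norm u * (1 - c * norm
         (P2 x)) + d * norm (P2 x)]; comparing the two isolates [norm (P2 x)]. *)
      assert (Hz : norm (P2 x) < h).
      { assert (H := norm_triangle_inv (T x) u); apply Rabs_le_between in H.
        assert (H' := norm_triangle (T (proj1_sig (P1 x))) (T (proj1_sig (P2 x)))).
        rewrite -HTx in H'.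
        assert (H3 : norm u * norm (P1 x) <= norm u * (1 - c * norm (P2 x)))
          by (apply Rmult_le_compat_l; [apply norm_ge_0|lra]).
        apply Rmult_lt_reg_r with (c * norm u - d); [exact Hg|lra]. }
      exists (T (proj1_sig (P1 x))); split.
      * exists (P1 x); split; [nra|reflexivity].
      * replace (minus (T (proj1_sig (P1 x))) u)
          with (minus (minus (T x) u) (T (proj1_sig (P2 x)))).
        -- apply Rle_lt_trans with (1 := norm_triangle _ _).
           rewrite norm_opp; nra.
        -- rewrite HTx; unfold minus.
           rewrite -!plus_assoc; f_equal.
           rewrite plus_comm -plus_assoc plus_opp_l; apply plus_zero_r.
  - intros x Hx; assert (H := HTS (proj1_sig x)); rewrite HP11 in H.
    apply Rle_trans with (1 := H).
    change (norm (proj1_sig x)) with (norm x); nra.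
Qed.

(** * Summands of the codomain *)

Lemma absolute_sum_norming_operator {K : AbsRing} (emb : R -> K)
  (Y : NormedModule K) (N : R * R -> R) (Y1 Y2 : closed_subspace Y)
  (P1 : Y -> subspace Y1) (P2 : Y -> subspace Y2) (u : Y) :
  is_real_embedding emb -> has_norming_functionals emb -> is_absolute_norm N ->
  is_linear P1 -> is_linear P2 ->
  (forall y, norm y = N (norm (P1 y), norm (P2 y))) ->
  0 < norm (P1 u) ->
  exists G : Y -> subspace Y1, is_linear G /\
    (forall y, norm (G y) <= norm y) /\ norm u <= norm (G u) /\
    forall y, norm (minus (G y) (P1 y)) * norm (P1 u) <=
      norm (P2 u) * norm (P1 y) + norm (P1 u) * norm (P2 y).
Proof.
  intros He Hf HN HP1 HP2 Hnorm Hs.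
  assert (Ht := norm_ge_0 (P2 u)).
  destruct (absolute_norm_norming N HN _ _ (Rlt_le _ _ Hs) Ht)
    as [a [b [Ha [Hb [Hab HabN]]]]].
  destruct (Hf (subspace Y2) (P2 u)) as [f [Hfplus [Hfscal [Hfle Hfu]]]].
  (* The multiple of [P1 u] of norm [b]: the second term of [G y] then has norm at most
     [b * norm (P2 y)], and the choice of [a] and [b] makes [G] a contraction. *)
  pose (v := scal (emb (b / norm (P1 u))) (P1 u)).
  assert (Hbs : 0 <= b / norm (P1 u)) by (apply Rdiv_le_0_compat; lra).
  assert (Hv : norm v = b).
  { unfold v; rewrite (norm_scal_emb _ _ _ _ He) (Rabs_pos_eq _ Hbs).
    field; lra. }
  pose (G := fun y => plus (scal (emb a) (P1 y)) (scal (f (P2 y)) v)).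
  assert (Hfv : forall y, norm (scal (f (P2 y)) v) <= b * norm (P2 y)).
  { intros y; apply Rle_trans with (1 := norm_scal _ _); rewrite Hv.
    assert (H := Hfle (P2 y)); nra. }
  assert (HG : forall y, norm (G y) <= norm y).
  { intros y; apply Rle_trans with (1 := norm_triangle _ _).
    rewrite (norm_scal_emb _ _ _ _ He) (Rabs_pos_eq a (proj1 Ha)) (Hnorm y).
    apply Rle_trans with (2 := HabN _ _ (norm_ge_0 _) (norm_ge_0 _)).
    specialize (Hfv y); lra. }
  exists G; split; [|split; [exact HG|split]].
  - split.
    + intros x y; unfold G.
      rewrite (linear_plus _ HP1) (linear_plus _ HP2) Hfplus.
      rewrite scal_distr_l scal_distr_r -!plus_assoc; f_equal.
      rewrite !plus_assoc; f_equal; apply plus_comm.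
    + intros k y; unfold G.
      rewrite (linear_scal _ HP1) (linear_scal _ HP2) Hfscal.
      rewrite scal_distr_l !scal_assoc (emb_central _ He); reflexivity.
    + exists 1; split; [lra|]; intros y; rewrite Rmult_1_l; apply HG.
  (* At [u] both terms are nonnegative multiples of [P1 u], so their norms add up without loss. *)
  - assert (HGu : G u = scal (emb (a + norm (P2 u) * (b / norm (P1 u)))) (P1 u)).
    { unfold G, v; rewrite Hfu scal_assoc -(emb_mult _ He) (emb_plus _ He).
      symmetry; exact (scal_distr_r _ _ (P1 u)). }
    rewrite HGu (norm_scal_emb _ _ _ _ He) Rabs_pos_eq.
    + rewrite (Hnorm u).
      replace ((a + norm (P2 u) * (b / norm (P1 u))) * norm (P1 u))
        with (a * norm (P1 u) + b * norm (P2 u)) by (field; lra).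
      exact Hab.
    + apply Rplus_le_le_0_compat; [lra|now apply Rmult_le_pos].
  - intros y.
    assert (H : norm (minus (G y) (P1 y)) <=
                  (1 - a) * norm (P1 y) + norm (P2 y)).
    { replace (minus (G y) (P1 y))
        with (plus (scal (emb (a - 1)) (P1 y)) (scal (f (P2 y)) v)).
      - apply Rle_trans with (1 := norm_triangle _ _).
        rewrite (norm_scal_emb _ _ _ _ He) Rabs_left1; [|lra].
        assert (H := norm_ge_0 (P2 y)); specialize (Hfv y); nra.
      - assert (Ha1 : scal (emb a) (P1 y) =
                        plus (scal (emb (a - 1)) (P1 y)) (P1 y)).
        { rewrite -{3}(scal_one (P1 y)) -(emb_one _ He).
          replace a with (a - 1 + 1) at 1 by ring.
          rewrite (emb_plus _ He); exact (scal_distr_r _ _ (P1 y)). }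
        unfold G, minus; rewrite Ha1 -!plus_assoc; f_equal.
        rewrite (plus_comm (scal (f (P2 y)) v)) plus_assoc plus_opp_r.
        symmetry; apply plus_zero_l. }
    (* From [norm (P1 u) <= N (norm (P1 u), norm (P2 u)) <= a * norm (P1 u) + b * norm (P2 u)] and
       [b <= 1]. *)
    assert (Hu : (1 - a) * norm (P1 u) <= norm (P2 u)).
    { assert (H1 := absolute_norm_ge_fst N HN (norm (P1 u)) (norm (P2 u))).
      rewrite (Rabs_pos_eq _ (Rlt_le _ _ Hs)) in H1; nra. }
    assert (H1 := norm_ge_0 (P1 y)); assert (H2 := norm_ge_0 (P2 y)).
    apply Rmult_le_compat_r with (r := norm (P1 u)) in H; [|lra].
    apply Rmult_le_compat_r with (r := norm (P1 y)) in Hu; [|lra].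
    apply Rle_trans with (1 := H); nra.
Qed.

Lemma QNA_dense_codomain_summand {K : AbsRing} (emb : R -> K)
  (X Y : NormedModule K) (N : R * R -> R) (Y1 Y2 : closed_subspace Y) :
  is_real_embedding emb -> has_norming_functionals emb ->
  is_absolute_norm N -> is_absolute_sum N Y1 Y2 ->
  QNA_dense X Y -> QNA_dense X (subspace Y1).
Proof.
  intros He Hf HN Hsum Hd.
  destruct (absolute_sum_projections N Y1 Y2 HN Hsum)
    as [P1 [P2 [HP1 [HP2 [Hdec [Hnorm [HP11 [HP21 _]]]]]]]].
  assert (HP1le : forall y, norm (P1 y) <= norm y).
  { intros y; rewrite (Hnorm y).
    apply Rle_trans with (1 := Rle_abs _), absolute_norm_ge_fst, HN. }
  assert (HP2le : forall y, norm (P2 y) <= norm y).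
  { intros y; rewrite (Hnorm y).
    apply Rle_trans with (1 := Rle_abs _), absolute_norm_ge_snd, HN. }
  apply QNA_dense_intro; intros S HS Hpos eps Heps.
  (* The total error will be [3 * d + d], hence [eps / 4]. The bound [op_norm S / 3] gives
     [norm (P1 u) >= op_norm S - 2 * d >= d], so [P1 u] is nonzero and
     [norm u <= 2 * norm (P1 u)]. *)
  pose (d := Rmin (eps / 4) (op_norm S / 3)).
  assert (Hd0 : 0 < d) by (apply Rmin_glb_lt; lra).
  assert (Hdeps : d <= eps / 4) by apply Rmin_l.
  assert (Hdl : d <= op_norm S / 3) by apply Rmin_r.
  assert (HS' : is_linear (fun x => proj1_sig (S x) : Y))
    by exact (is_linear_comp _ _ HS (is_linear_inclusion Y1)).
  destruct (QNA_dense_approx emb He Hd _ HS' d Hd0)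
    as [T [u [HT [HTle [Hu [HTS HSu]]]]]].
  (* The norm of [Y1] is inherited, so [S] has the same operator norm as a map into [Y]. *)
  change (op_norm S <= norm u + d) in HSu.
  assert (HT1 : forall x, norm (minus (P1 (T x)) (S x)) <= d * norm x).
  { intros x; rewrite -{1}(HP11 (S x)) -(linear_minus _ _ _ HP1).
    apply Rle_trans with (1 := HP1le _), HTS. }
  (* [P2] kills the values of [S], so [P2 (T x)] is the projected error; the bound passes to the
     limit [u] next. *)
  assert (HT2 : forall x, norm (P2 (T x)) <= d * norm x).
  { intros x; rewrite -(minus_zero_r (P2 (T x))) -(HP21 (S x)).
    rewrite -(linear_minus _ _ _ HP2).
    apply Rle_trans with (1 := HP2le _), HTS. }
  assert (Hu2 : norm (P2 u) <= d).
  { apply le_epsilon; intros e Hepos.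
    destruct (Hu (mkposreal e Hepos)) as [y [[x [Hx ->]] Hxu]]; simpl in Hxu.
    assert (H := norm_triangle_inv (P2 (T x)) (P2 u)).
    rewrite -(linear_minus _ _ _ HP2) in H.
    assert (H' := HP2le (minus (T x) u)).
    apply Rabs_le_between in H; specialize (HT2 x); nra. }
  assert (Hu12 : norm u <= norm (P1 u) + norm (P2 u)).
  { rewrite {1}(Hdec u); apply (norm_triangle (proj1_sig (P1 u))). }
  destruct (absolute_sum_norming_operator emb Y N Y1 Y2 P1 P2 u He Hf HN HP1 HP2
    Hnorm ltac:(lra)) as [G [HGlin [HGle [HGu HGP]]]].
  exists (fun x => G (T x)); split.
  - apply QNA_intro with (G u).
    + now apply is_linear_comp.
    + intros x; apply Rle_trans with (1 := HGle _), Rle_trans with (1 := HTle x).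
      apply Rmult_le_compat_r; [apply norm_ge_0|exact HGu].
    + intros e; destruct (Hu e) as [y [[x [Hx ->]] Hxu]].
      exists (G (T x)); split; [now exists x|].
      rewrite -(linear_minus _ _ _ HGlin).
      apply Rle_lt_trans with (1 := HGle _), Hxu.
  - intros x Hx.
    assert (H := HGP (T x)); assert (H1 := HP1le (T x)).
    assert (H2 := HTle x); assert (H0 := norm_ge_0 x).
    assert (H3 : norm (T x) <= 2 * norm (P1 u)) by nra.
    assert (H4 : norm (P2 u) * norm (P1 (T x)) <= d * (2 * norm (P1 u)))
      by (apply Rmult_le_compat; try apply norm_ge_0; lra).
    assert (H5 : norm (P2 (T x)) <= d) by (specialize (HT2 x); nra).
    (* After multiplication by [norm (P1 u)], the term with [P2 u] contributes [2 * d] and the term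
       with [P2 (T x)] contributes [d]. *)
    assert (H6 : norm (minus (G (T x)) (P1 (T x))) <= 3 * d).
    { apply Rmult_le_reg_r with (norm (P1 u)); nra. }
    rewrite (minus_trans (P1 (T x))).
    apply Rle_trans with (1 := norm_triangle _ _).
    specialize (HT1 x); nra.
Qed.

Theorem proposition6p1 :
  forall (K : AbsRing) (HK : K = R_AbsRing \/ K = C_AbsRing)
    (X Y : CompleteNormedModule K) (Hdense : QNA_dense X Y),
    (forall X1 : closed_subspace X,
        is_absolute_summand_type1 X1 -> QNA_dense (subspace X1) Y) /\
    (forall X1 : closed_subspace X,
        is_L_summand X1 -> QNA_dense (subspace X1) Y) /\
    (forall Y1 : closed_subspace Y,
        is_absolute_summand Y1 -> QNA_dense X (subspace Y1)).
Proof.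
  intros K HK X Y Hdense.
  destruct (exists_real_embedding K HK) as [emb [He Hf]].
  split; [|split].
  - intros X1 [N [HN [H1 [X2 Hsum]]]].
    destruct (type1_lower_bound N HN H1) as [c [Hc HcN]].
    exact (QNA_dense_domain_summand emb X Y N c X1 X2 He HN Hsum Hc HcN Hdense).
  - intros X1 [X2 Hsum].
    apply (QNA_dense_domain_summand emb X Y norm_l1 1 X1 X2 He norm_l1_absolute
      Hsum Rlt_0_1); [|exact Hdense].
    intros s t; unfold norm_l1; simpl; lra.
  - intros Y1 [N [HN [Y2 Hsum]]].
    exact (QNA_dense_codomain_summand emb X Y N Y1 Y2 He Hf HN Hsum Hdense).
Qed.
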